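(* Let $n\ge2$. Let $g:[0,\infty)\to\mathbb{R}$ be a (continuous) Bernstein function with $g(0)=0$, and let $a\ge0$ be the coefficient in its unique representation $$g(t)=at+\int_0^\infty(1-e^{-rt})\frac{1+r}{r}\,d\sigma(r),\qquad t\ge0,$$ where $\sigma$ is a finite nonnegative measure on $(0,\infty)$. Suppose that either $g(t)=at$ for every $t\geq0$, or $\lim_{t\to\infty}[g(t)-at]=\infty$. Then for every lower set $T\subseteq\Pi_n$, the function $T[e^{-g(\|\cdot\|^2)}]$ is identically zero on $\mathbb{R}^n$ if and only if $g(t)=at$ for every $t\ge0$.
   Context: $\Pi_n$ denotes the set of all partitions of $\{1,\dots,n\}$ into nonempty disjoint blocks, ordered by refinement: $\pi\le\sigma$ iff every block of $\pi$ is contained in a block of $\sigma$; $|\pi|$ is the number of blocks; $\hat{\mathbf{0}}_n$ is the partition into singletons and $\hat{\mathbf{1}}_n$ the one-block partition. A lower set of $\Pi_n$ is a subset $T$ containing $\hat{\mathbf 0}_n$ and $\hat{\mathbf 1}_n$ such that $w\in T\setminus\{\hat{\mathbf 1}_n\}$, $z\in\Pi_n$, $z\le w$ imply $z\in T$. With the induced order, $\mu$ is the M\''obius function of the poset $T$: $\mu(x,x)=1$, $\mu(x,y)=-\sum_{z\in T,\,x\le z<y}\mu(x,z)$ for $x<y$ in $T$, $0$ otherwise. For $t\in\mathbb{R}^n$ and $F\subseteq\{1,\dots,n\}$, $(t_F,\vec{0})\in\mathbb{R}^n$ agrees with $t$ on $F$ and is zero off $F$. For $f:\mathbb{R}^n\to\mathbb{C}$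 continuous positive definite with $f(0)=1$ and $\pi=(F_1,\dots,F_{|\pi|})$, $f_\pi(t):=\prod_{i=1}^{|\pi|}f(t_{F_i},\vec{0})$ and $T[f](t):=\sum_{\pi\in T}\mu(\pi,\hat{\mathbf{1}}_n)f_\pi(t)$. Here $f(x)=e^{-g(\|x\|^2)}$ with $\|\cdot\|$ the Euclidean norm on $\mathbb{R}^n$. The Bernstein functions with $g(0)=0$ are exactly the functions having a representation as displayed in the claim. *)

(* Defs.v *)
From HB Require Import structures.
From mathcomp Require Import all_boot all_order all_algebra.

Set Implicit Arguments.
Unset Strict Implicit.
Unset Printing Implicit Defensive.

Import Order.TTheory GRing.Theory Num.Theory.

Local Open Scope ring_scope.

Record setpart (n : nat) := SetPart {
  blocks : {set {set 'I_n}};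
  blocksP : partition blocks [set: 'I_n] }.

HB.instance Definition _ n := [isSub for @blocks n].
HB.instance Definition _ n := [Finite of setpart n by <:].

Section SetPartOrder.
Variable n : nat.
Implicit Types p q r : setpart n.

Definition refines p q :=
  [forall B in blocks p, [exists C in blocks q, B \subset C]].

Lemma refinesP p q :
  reflect (forall B, B \in blocks p -> exists2 C, C \in blocks q & B \subset C)
          (refines p q).
Proof. by apply: (iffP forall_inP) => h B /h /exists_inP. Qed.

Lemma refines_refl : reflexive refines.
Proof. by move=> p; apply/refinesP => B Bp; exists B. Qed.

Lemma refines_trans : transitive refines.
Proof.
move=> q p r /refinesP pq /refinesP qr; apply/refinesP => B /pq[C /qr[D Dr CD] BC].
by exists D => //; exact: subset_trans CD.
Qed.

Lemma refines_anti : antisymmetric refines.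
Proof.
have sub p q : refines p q -> refines q p -> blocks p \subset blocks q.
  move=> /refinesP pq /refinesP qp; apply/subsetP => B Bp.
  have [C Cq BC] := pq _ Bp; have [D Dp CD] := qp _ Cq.
  have /and3P[_ /trivIsetP tI p0] := blocksP p.
  have [BD|BD] := eqVneq B D.
    by suff -> : B = C by []; apply/eqP; rewrite eqEsubset BC BD.
  have B0 : B = set0.
    apply/eqP; rewrite -subset0 -(disjoint_setI0 (tI _ _ Bp Dp BD)).
    by rewrite subsetI subxx (subset_trans BC CD).
  by rewrite B0 (negPf p0) in Bp.
move=> p q /andP[pq qp]; apply/val_inj/eqP.
by rewrite eqEsubset !sub.
Qed.

Fact setpart_display : Order.disp_t. Proof. exact: Order.Disp tt tt. Qed.

HB.instance Definition _ :=
  Order.Le_isPOrder.Build setpart_display (setpart n)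
    refines_refl refines_anti refines_trans.

Fact bot_partition :
  partition [set [set i] | i : 'I_n] [set: 'I_n].
Proof.
apply/and3P; split.
- apply/eqP/setP => i; rewrite in_setT; apply/bigcupP.
  by exists [set i]; rewrite ?in_set1 //; apply/imsetP; exists i.
- apply/trivIsetP => _ _ /imsetP[i _ ->] /imsetP[j _ ->] ij.
  rewrite disjoints1 in_set1.
  by apply: contra ij => /eqP ->.
- apply/negP => /imsetP[i _] /setP/(_ i).
  by rewrite in_set0 in_set1 eqxx.
Qed.

(* Removing the empty set only matters for n = 0, where the only partition has
   no block. *)
Fact top_partition :
  partition ([set [set: 'I_n]] :\ set0)%SET [set: 'I_n].
Proof.
apply/and3P; split.
- apply/eqP/setP => i; rewrite in_setT; apply/bigcupP.
  exists [set: 'I_n]; rewrite ?in_setT // !inE eqxx andbT.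
  by apply/set0Pn; exists i; rewrite in_setT.
- apply/trivIsetP => A B; rewrite !inE.
  by move=> /andP[_ /eqP ->] /andP[_ /eqP ->]; rewrite eqxx.
- by rewrite !inE eqxx.
Qed.

Definition setpart_bot := SetPart bot_partition.
Definition setpart_top := SetPart top_partition.

Fact setpart_bot_le p : (setpart_bot <= p)%O.
Proof.
apply/refinesP => _ /imsetP[i _ ->].
have /and3P[/eqP cp _ _] := blocksP p.
have : i \in cover (blocks p) by rewrite cp in_setT.
by move=> /bigcupP[C Cp iC]; exists C => //; rewrite sub1set.
Qed.

Fact setpart_le_top p : (p <= setpart_top)%O.
Proof.
apply/refinesP => B Bp; exists [set: 'I_n]; last exact: subsetT.
have /and3P[_ _ p0] := blocksP p.
rewrite !inE eqxx andbT; apply: contraNneq p0 => T0.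
by have := subsetT B; rewrite T0 subset0 => /eqP <-.
Qed.

HB.instance Definition _ :=
  Order.hasBottom.Build setpart_display (setpart n) setpart_bot_le.
HB.instance Definition _ :=
  Order.hasTop.Build setpart_display (setpart n) setpart_le_top.

Lemma setpart_leP p q :
  reflect (forall B, B \in blocks p -> exists2 C, C \in blocks q & B \subset C)
          (p <= q)%O.
Proof. exact: refinesP. Qed.

Lemma blocks_bot : blocks \bot%O = [set [set i] | i : 'I_n].
Proof. by []. Qed.

Lemma blocks_top : (0 < n)%N -> blocks \top%O = [set [set: 'I_n]].
Proof.
move=> n0; apply/setP => B; rewrite !inE.
case: (eqVneq B [set: 'I_n]) => [->|_]; last by rewrite andbF.
by rewrite andbT; apply/set0Pn; exists (Ordinal n0); rewrite in_setT.
Qed.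

End SetPartOrder.

Section Mobius.
Context {d : Order.disp_t} {P : finPOrderType d}.
Variable T : {set P}.

Fixpoint mobius_rec (k : nat) (x y : P) : int :=
  if k is k'.+1 then
    if x == y then 1
    else if (x < y)%O then
      - \sum_(z in T | (x <= z)%O && (z < y)%O) mobius_rec k' x z
    else 0
  else 0.

(* The fuel exceeds the length of any chain of T; mobius_eq, mobius_lt and
   mobius_nle are the defining equations. *)
Definition mobius : P -> P -> int := mobius_rec #|T|.+1.

Let itv x y := [set z in T | (x <= z)%O && (z < y)%O].

Lemma mobius_rec_fuel k l x y : (#|itv x y| < k)%N -> (#|itv x y| < l)%N ->
  mobius_rec k x y = mobius_rec l x y.
Proof.
elim: k l y => [//|k IH] [//|l] y /= hk hl.
case: ifP => // _; case: ifP => // _; congr (- _).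
apply: eq_bigr => z /and3P[zT xz zy].
have lt : (#|itv x z| < #|itv x y|)%N.
  apply: proper_card; apply/properP; split.
    apply/subsetP => w; rewrite !inE => /and3P[-> -> wz] /=.
    exact: lt_trans zy.
  by exists z; rewrite !inE zT xz ?zy ?ltxx.
by apply: IH; [exact: leq_trans lt hk | exact: leq_trans lt hl].
Qed.

Lemma mobius_eq x : mobius x x = 1.
Proof. by rewrite /mobius /= eqxx. Qed.

Lemma mobius_lt x y : (x < y)%O ->
  mobius x y = - \sum_(z in T | (x <= z)%O && (z < y)%O) mobius x z.
Proof.
move=> xy; rewrite {1}/mobius /= xy lt_eqF //; congr (- _).
apply: eq_bigr => z /and3P[zT xz zy]; apply: mobius_rec_fuel.
  apply: proper_card; apply/properP; split.
    by apply/subsetP => w; rewrite !inE => /and3P[].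
  by exists z => //; rewrite !inE ltxx !andbF.
by rewrite ltnS subset_leq_card //; apply/subsetP => w; rewrite !inE => /and3P[].
Qed.

Lemma mobius_nle x y : ~~ (x <= y)%O -> mobius x y = 0.
Proof. by rewrite le_eqVlt negb_or /mobius /= => /andP[/negPf -> /negPf ->]. Qed.

End Mobius.

Definition lower_set (n : nat) (T : {set setpart n}) : Prop :=
  [/\ \bot%O \in T, \top%O \in T &
      forall w z : setpart n,
        w \in T -> w != \top%O -> (z <= w)%O -> z \in T].

(* The vector (t_F, 0): the coordinates off F are set to zero. *)
Definition restr_coord (K : pzRingType) (n : nat) (F : {set 'I_n})
    (t : 'rV[K]_n) : 'rV[K]_n :=
  \row_i (if i \in F then t 0 i else 0).

(* The codomain K is the field of complex numbers in general; for real-valued f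
   one may take K to be the reals, the values of mobius being integers. *)
Definition part_prod (R : pzRingType) (K : comNzRingType) (n : nat)
    (f : 'rV[R]_n -> K) (p : setpart n) (t : 'rV[R]_n) : K :=
  \prod_(F in blocks p) f (restr_coord F t).

Definition lower_sum (R : pzRingType) (K : comNzRingType) (n : nat)
    (T : {set setpart n}) (f : 'rV[R]_n -> K) (t : 'rV[R]_n) : K :=
  \sum_(p in T) (mobius T p \top%O)%:~R * part_prod f p t.

(* The library norm on 'rV[R]_n is the sup norm. *)
Definition enorm (R : rcfType) (n : nat) (x : 'rV[R]_n) : R :=
  Num.sqrt (\sum_(i < n) x 0 i ^+ 2).

From mathcomp Require Import all_classical all_reals all_analysis.
Import numFieldNormedType.Exports.

Local Open Scope classical_set_scope.

(* Bernstein functions on [0, oo[: nonnegative, continuous on [0, oo[, smooth on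
   ]0, oo[ with completely monotone derivative. They are represented by total
   functions whose values on negative reals are irrelevant. *)
Definition bernstein (R : realType) (g : R -> R) : Prop :=
  [/\ {within `[0, +oo[, continuous g},
      forall x : R, 0 <= x -> 0 <= g x &
      forall (k : nat) (x : R), 0 < x ->
        derivable (derive1n k g) x 1 /\ 0 <= (-1) ^+ k * derive1n k.+1 g x].

(* A finite measure on ]0, oo[ is a finite Borel measure on R that does not
   charge ]-oo, 0]. *)
Definition bernstein_repr (R : realType) (g : R -> R) (a : R)
    (sigma : {finite_measure set R -> \bar R}) : Prop :=
  sigma `]-oo, 0] = 0%E /\
  forall t : R, 0 <= t ->
    (g t)%:E = ((a * t)%:E +
      \int[sigma]_(r in `]0%R, +oo[)
        ((1 - expR (- (r * t))) * ((1 + r) / r))%:E)%E.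

(* Main.v *)
Require Import Defs.
From HB Require Import structures.
From mathcomp Require Import all_boot all_order all_algebra.
From mathcomp Require Import all_classical all_reals all_analysis.
From mathcomp Require Import measurable_realfun ring lra.

(** Write nu for the measure (1 + r) / r dsigma(r). If g is linear, every
    product over the blocks of a partition equals exp(-a |x|^2), and the sum of
    the Moebius values mu(p, 1) over the whole poset T vanishes
    ([mobius_sum_first]), so the signed sum is zero.

    Conversely, the slope a drops out of the failure of additivity of g:
    since (1 - e^{-ru}) + (1 - e^{-rv})
          = (1 - e^{-r(u+v)}) + (1 - e^{-ru})(1 - e^{-rv}),
    one gets g(u) + g(v) = g(u + v) + E(u, v), where E(u, v) is the integral of
    (1 - e^{-ru})(1 - e^{-rv}) against nu ([defectE]). It is nonnegative and
    nondecreasing in u and v. Evaluate the signed sum at the point all of whose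
    coordinates are sqrt s: the term of a partition p is
    exp(- sum_F g(|F| s)), and when p has at least two blocks the exponent
    exceeds g(n s) by at least E(s, s) ([subadditive_blocks]). If the sum is
    zero, the term exp(- g(n s)) of the one-block partition is balanced by the
    others, which forces exp(E(s, s)) <= sum_p |mu(p, 1)|
    ([lower_sum_eq0_defect_le]). Hence E(s, s) is bounded in s. As s grows it
    increases to the total mass of nu, by monotone convergence; so nu is
    finite, and then g(t) - a t, the integral of 1 - e^{-rt} against nu, is
    bounded ([defect_bounded]). This contradicts its divergence. *)

Import Order.TTheory GRing.Theory Num.Theory.
Import numFieldNormedType.Exports.

Local Open Scope classical_set_scope.
Local Open Scope ring_scope.

(** * Moebius functions and partitions *)

(** The recursion defining the Moebius function sums over its second argument:
    it says M Z = 1 for the Moebius matrix M and the zeta matrix Z of T. For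
    square matrices over a commutative ring this implies Z M = 1, which is the
    same recursion in the first argument. *)
Lemma mobius_sum_first d (P : finPOrderType d) (T : {set P}) (x y : P) :
  x \in T -> y \in T -> (x < y)%O ->
  \sum_(z in T | (x <= z)%O && (z <= y)%O) mobius T z y = 0.
Proof.
move=> xT yT xy.
pose M := \matrix_(i < #|T|, j < #|T|) mobius T (enum_val i) (enum_val j).
pose Z : 'M[int]_#|T| := \matrix_(i < #|T|, j < #|T|)
  ((enum_val i <= enum_val j)%O : nat)%:R.
have mulE (A B : 'M[int]_#|T|) (F : P -> P -> P -> int) :
    (forall i j k, A i k * B k j = F (enum_val i) (enum_val j) (enum_val k)) ->
    forall i j, (A *m B) i j = \sum_(z in T) F (enum_val i) (enum_val j) z.
  move=> h i j; rewrite mxE [RHS]big_enum_val;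
  apply: eq_bigr => k _; exact: h.
have MZ : M *m Z = 1%:M.
  apply/matrixP => i j.
  rewrite (mulE _ _ (fun x y z => mobius T x z * ((z <= y)%O : nat)%:R)); last first.
    by move=> ? ? ?; rewrite !mxE.
  rewrite mxE -(inj_eq enum_val_inj); set u := enum_val i; set v := enum_val j.
  have vT : v \in T by exact: enum_valP.
  rewrite (bigID (fun z => (u <= z)%O && (z <= v)%O)) /= addrC big1 ?add0r; last first.
    move=> z /andP[_]; rewrite negb_and => /orP[uz|/negPf ->]; last by rewrite mulr0.
    by rewrite mobius_nle // mul0r.
  under eq_bigr => z /andP[_ /andP[_ ->]] do rewrite mulr1.
  have [<-|uv] := eqVneq u v.
    rewrite (bigD1 u) /=; last by rewrite lexx enum_valP.
    rewrite mobius_eq big1 ?addr0 // => z /andP[/andP[_ uzu] /negP[]].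
    by rewrite eq_le andbC.
  have [luv|nuv] := boolP (u <= v)%O; last first.
    rewrite big1 // => z /andP[_ /andP[uz zv]].
    by rewrite (le_trans uz zv) in nuv.
  have ltuv : (u < v)%O by rewrite lt_neqAle uv.
  rewrite (bigD1 v) /= ?vT ?luv ?lexx // (mobius_lt _ ltuv) addrC.
  apply/eqP; rewrite subr_eq0; apply/eqP; apply: eq_bigl => z.
  by rewrite lt_neqAle; case: (z \in T); case: (u <= z)%O; rewrite //= andbC.
have ZM := mulmx1C MZ.
have := congr1 (fun (A : 'M[int]_#|T|) =>
  A (enum_rank_in xT x) (enum_rank_in xT y)) ZM.
rewrite (mulE _ _ (fun x y z => ((x <= z)%O : nat)%:R * mobius T z y)); last first.
  by move=> ? ? ?; rewrite !mxE.
rewrite mxE -(inj_eq enum_val_inj) !enum_rankK_in // (lt_eqF xy) => SE.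
apply: etrans SE.
rewrite [RHS](bigID (fun z => (x <= z)%O && (z <= y)%O)) /= [X in _ + X]big1 ?addr0.
  by apply: eq_bigr => z /andP[_ /andP[-> _]]; rewrite mul1r.
move=> z /andP[_]; rewrite negb_and => /orP[/negPf ->|zy]; first by rewrite mul0r.
by rewrite mobius_nle // mulr0.
Qed.

Lemma setpart_bot_lt_top n : (2 <= n)%N -> (\bot < \top :> setpart n)%O.
Proof.
move=> n2; rewrite lt_neqAle lex1 andbT; apply/eqP => e.
have n0 : (0 < n)%N by exact: leq_trans n2.
have : [set Ordinal n0]%SET \in blocks (\bot%O : setpart n).
  by rewrite blocks_bot; apply/imsetP; exists (Ordinal n0).
rewrite e blocks_top // inE => /eqP/setP/(_ (Ordinal n2)).
by rewrite !inE.
Qed.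

Lemma sum_blocks n (V : nmodType) (p : setpart n) (F : 'I_n -> V) :
  \sum_(B in blocks p) \sum_(i in B) F i = \sum_i F i.
Proof.
have /and3P[/eqP cp tI _] := blocksP p.
by rewrite -finset.big_trivIset // cp; apply: eq_bigl => i; rewrite inE.
Qed.

Lemma enorm_sqr (R : rcfType) n (x : 'rV[R]_n) :
  enorm x ^+ 2 = \sum_i x 0 i ^+ 2.
Proof. by rewrite sqr_sqrtr // sumr_ge0 // => i _; exact: sqr_ge0. Qed.

Lemma enorm_restr_coord (R : rcfType) n (F : {set 'I_n}) (x : 'rV[R]_n) :
  enorm (restr_coord F x) ^+ 2 = \sum_(i in F) x 0 i ^+ 2.
Proof.
rewrite enorm_sqr [RHS]big_mkcond /=; apply: eq_bigr => i _; rewrite mxE.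
by case: ifP => // _; rewrite expr0n.
Qed.

(** * The signed sum for a radial exponential *)

Lemma part_prod_radial (R : realType) n (g : R -> R) (p : setpart n) (x : 'rV[R]_n) :
  part_prod (fun y : 'rV[R]_n => expR (- g (enorm y ^+ 2))) p x
  = expR (- \sum_(F in blocks p) g (\sum_(i in F) x 0 i ^+ 2)).
Proof.
rewrite /part_prod -sumrN expR_sum; apply: eq_bigr => F _.
by rewrite enorm_restr_coord.
Qed.

(** For linear g the exponents over the blocks add up to the same number for
    every partition, and only the Moebius values remain. *)
Lemma lower_sum_linear (R : realType) n (g : R -> R) (a : R) (T : {set setpart n}) :
  (2 <= n)%N -> lower_set T -> (forall t, 0 <= t -> g t = a * t) ->
  forall x : 'rV[R]_n,
    lower_sum T (fun y : 'rV[R]_n => expR (- g (enorm y ^+ 2))) x = 0.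
Proof.
move=> n2 [botT topT _] ga x; rewrite /lower_sum.
pose c := expR (- (a * \sum_i x 0 i ^+ 2)).
rewrite (eq_bigr (fun p => (mobius T p \top%O)%:~R * c)) => [|p _]; last first.
  rewrite part_prod_radial /c; do 3 congr (_ _).
  rewrite -(sum_blocks _ _ p) mulr_sumr; apply: eq_bigr => F _.
  by rewrite ga // sumr_ge0 // => i _; exact: sqr_ge0.
rewrite -mulr_suml -rmorph_sum /=.
rewrite (_ : \sum_(p in T) mobius T p \top%O = 0) ?mul0r //.
rewrite -[RHS](mobius_sum_first _ _ _ _ _ botT topT (setpart_bot_lt_top n n2)).
by apply: eq_bigl => z; rewrite le0x lex1 !andbT.
Qed.

(** Here e bounds from below the failure of additivity of g at arguments at
    least s. *)
Section Subadditive.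
Variables (R : realType) (n : nat) (g : R -> R) (s e : R).
Hypotheses (s0 : 0 <= s) (g0 : g 0 = 0).
Hypothesis gD : forall u v, 0 <= u -> 0 <= v -> g (u + v) <= g u + g v.
Hypothesis gDe : forall u v, s <= u -> s <= v -> g (u + v) + e <= g u + g v.

Lemma subadditive_sum (I : finType) (A : {pred I}) (u : I -> R) :
  (forall i, 0 <= u i) -> g (\sum_(i in A) u i) <= \sum_(i in A) g (u i).
Proof.
move=> u0.
suff : 0 <= \sum_(i in A) u i /\ g (\sum_(i in A) u i) <= \sum_(i in A) g (u i).
  by case.
elim/big_rec2: _ => [|i x y _ [x0 xy]]; first by rewrite g0.
split; first exact: addr_ge0.
by apply: le_trans (gD _ _ (u0 i) x0) _; rewrite lerD2l.
Qed.

(** Split off one block B: the other blocks merge by subadditivity into one of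
    size n - #|B|, which is positive because p is not the one-block partition,
    and merging it with B gains e. *)
Lemma subadditive_blocks (p : setpart n) : (0 < n)%N -> p != \top%O ->
  g (n%:R * s) + e <= \sum_(F in blocks p) g (#|F|%:R * s).
Proof.
move=> n0 ptop.
have /and3P[/eqP cp tI p0] := blocksP p.
have /bigcupP[B Bp nB] : Ordinal n0 \in finset.cover (blocks p) by rewrite cp inE.
have BT : B != [set: 'I_n]%SET.
  apply: contra ptop => /eqP BT; rewrite eq_le lex1 /=.
  by apply/setpart_leP => C _; exists B; rewrite // BT; apply/finset.subsetT.
rewrite (bigD1 B) //=.
have cB : (0 < #|B|)%N by rewrite card_gt0; apply/finset.set0Pn; exists (Ordinal n0).
have cBn : (#|B| < n)%N.
  by rewrite -[X in (_ < X)%N]card_ord -cardsT proper_card // finset.properT.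
have sumE : \sum_(F in blocks p | F != B) #|F|%:R * s = (n - #|B|)%:R * s.
  rewrite -mulr_suml -natr_sum; congr (_%:R * _).
  suff nE : n = (#|B| + \sum_(F in blocks p | F != B) #|F|)%N.
    by rewrite [X in (X - _)%N]nE addKn.
  by rewrite -[LHS]card_ord -cardsT (finset.card_partition (blocksP p)) (bigD1 B).
have les k : (0 < k)%N -> s <= k%:R * s by move=> k0; rewrite ler_peMl // ler1n.
have := gDe _ _ (les _ cB) (les (n - #|B|)%N _); rewrite subn_gt0 => /(_ cBn).
rewrite -mulrDl -natrD subnKC ?(ltnW cBn) // => /le_trans; apply.
rewrite lerD2l -sumE.
have := subadditive_sum _ [pred F in blocks p | F != B] (fun F => #|F|%:R * s).
by apply=> F; rewrite mulr_ge0.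
Qed.

(** At the diagonal point with coordinates sqrt s, every partition other than
    the top one contributes at most exp(-e) times the top term, up to its
    Moebius coefficient. *)
Lemma lower_sum_eq0_defect_le (T : {set setpart n}) : (0 < n)%N -> \top%O \in T ->
  lower_sum T (fun y : 'rV[R]_n => expR (- g (enorm y ^+ 2)))
    (const_mx (Num.sqrt s)) = 0 ->
  expR e <= \sum_(p in T) `|(mobius T p \top%O)%:~R|.
Proof.
move=> n0 topT; rewrite /lower_sum.
have ppE p : part_prod (fun y : 'rV[R]_n => expR (- g (enorm y ^+ 2))) p
    (const_mx (Num.sqrt s)) = expR (- \sum_(F in blocks p) g (#|F|%:R * s)).
  rewrite part_prod_radial; congr (expR (- _)); apply: eq_bigr => F _.
  by under eq_bigr do rewrite mxE sqr_sqrtr //; rewrite sumr_const mulr_natl.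
under eq_bigr do rewrite ppE.
rewrite [X in X = 0 -> _](bigD1 \top%O) // mobius_eq mul1r.
rewrite blocks_top // big_set1 cardsT card_ord.
move=> /eqP; rewrite addr_eq0 => /eqP topE.
(* The top partition only adds a nonnegative term to the bound. *)
rewrite [leRHS](bigD1 \top%O) //= -[leLHS]add0r lerD //.
suff : expR (- g (n%:R * s)) <=
    (\sum_(p in T | p != \top%O) `|(mobius T p \top%O)%:~R|) *
      expR (- (g (n%:R * s) + e)).
  rewrite opprD expRD [expR (- e)]expRN mulrCA.
  by rewrite ler_pMr ?expR_gt0 // ler_pdivlMr ?mul1r ?expR_gt0.
rewrite topE (le_trans (ler_norm _)) // normrN mulr_suml.
apply: le_trans (ler_norm_sum _ _ _) _; apply: ler_sum => p /andP[_ ptop].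
rewrite normrM ler_wpM2l // ger0_norm ?expR_ge0 // ler_expR lerN2.
exact: subadditive_blocks.
Qed.

End Subadditive.

(** * Integrals against the Levy measure *)

Section LevyIntegral.
Context {R : realType} (sigma : {finite_measure set R -> \bar R}).

(** The measure (1 + r) / r dsigma(r) is the Levy measure of the Bernstein
    function. It may be infinite near 0, so its integrals are taken as
    extended reals, of continuous functions that are nonnegative on ]0, oo[. *)
Definition levy_integral (f : R -> R) : \bar R :=
  (\int[sigma]_(r in `]0%R, +oo[) (f r * ((1 + r) / r))%:E)%E.

Let D : set R := `]0, +oo[.

Let DP r : D r -> 0 < r.
Proof. by rewrite /D /= in_itv /= andbT. Qed.

Let weight_ge0 (r : R) : 0 < r -> 0 <= (1 + r) / r.
Proof. by move=> r0; rewrite divr_ge0 // ?addr_ge0 // ltW. Qed.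

Let integrand_ge0 (f : R -> R) : (forall r : R, 0 < r -> 0 <= f r) ->
  forall r, D r -> (0 <= (f r * ((1 + r) / r))%:E)%E.
Proof.
by move=> f0 r /DP r0; rewrite lee_fin mulr_ge0 ?f0 ?weight_ge0.
Qed.

Let integrand_measurable (f : R -> R) : continuous f ->
  measurable_fun D (EFin \o (fun r : R => f r * ((1 + r) / r))).
Proof.
move=> cf; apply/measurable_EFinP.
apply: open_continuous_measurable_fun => [|r]; first exact: interval_open.
rewrite inE => /DP r0.
apply: cvgM; first exact: cf.
apply: cvgM; first by apply: cvgD; [exact: cvg_cst|exact: cvg_id].
by apply: cvgV; [rewrite gt_eqF|exact: cvg_id].
Qed.

Lemma levy_integral_ge0 (f : R -> R) : (forall r : R, 0 < r -> 0 <= f r) ->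
  (0 <= levy_integral f)%E.
Proof. by move=> f0; apply: integral_ge0 => r; exact: integrand_ge0. Qed.

Lemma le_levy_integral (f h : R -> R) : continuous f -> continuous h ->
  (forall r : R, 0 < r -> 0 <= f r <= h r) ->
  (levy_integral f <= levy_integral h)%E.
Proof.
move=> cf ch fh; apply: ge0_le_integral => //.
- by apply: integrand_ge0 => r /fh /andP[].
- exact: integrand_measurable.
- exact: integrand_measurable.
move=> r /DP r0; rewrite lee_fin ler_wpM2r ?weight_ge0 //.
by case/andP: (fh _ r0).
Qed.

Lemma levy_integralD (f h : R -> R) : continuous f -> continuous h ->
  (forall r : R, 0 < r -> 0 <= f r) -> (forall r : R, 0 < r -> 0 <= h r) ->
  (levy_integral (fun r => f r + h r)%R = levy_integral f + levy_integral h)%E.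
Proof.
move=> cf ch f0 h0; rewrite /levy_integral -ge0_integralD //.
- by apply: eq_integral => r _; rewrite -EFinD mulrDl.
- exact: integrand_ge0.
- exact: integrand_measurable.
- exact: integrand_ge0.
- exact: integrand_measurable.
Qed.

(** Monotone convergence: bounds on the integrals of functions increasing to 1
    bound the total mass of the Levy measure. *)
Lemma levy_integral_cst1_le (f : nat -> R -> R) (C : \bar R) :
  (forall k, continuous (f k)) ->
  (forall k r, 0 < r -> 0 <= f k r) ->
  (forall r : R, 0 < r -> {homo f^~ r : k l / (k <= l)%N >-> k <= l}) ->
  (forall r : R, 0 < r -> f k r @[k --> \oo] --> (1 : R)) ->
  (forall k, levy_integral (f k) <= C)%E ->
  (levy_integral (cst 1%R) <= C)%E.
Proof.
move=> cf f0 fle flim fC.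
pose F k r := (f k r * ((1 + r) / r))%:E.
have cv : levy_integral (f k) @[k --> \oo] -->
    (\int[sigma]_(r in D) limn (F^~ r))%E.
  apply: cvg_monotone_convergence => //.
  - by move=> k; exact: integrand_measurable.
  - by move=> k; apply: integrand_ge0; exact: f0.
  by move=> r Dr k l kl; rewrite lee_fin ler_wpM2r ?weight_ge0 ?fle ?DP.
have -> : levy_integral (cst 1%R) = (\int[sigma]_(r in D) limn (F^~ r))%E.
  apply: eq_integral => r /set_mem /DP r0.
  have lim1 : f k r * ((1 + r) / r) @[k --> \oo] --> 1 * ((1 + r) / r).
    by apply: cvgM; [exact: flim|exact: cvg_cst].
  by apply/esym/cvg_lim => //; apply: cvg_EFin lim1; exact: nearW.
by apply: (cvge_to_le cv); apply: nearW => k; exact: fC.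
Qed.

End LevyIntegral.

Section ExpDefect.
Context {R : realType}.

Definition one_sub_exp (t r : R) : R := 1 - expR (- (r * t)).

Lemma continuous_one_sub_exp t : continuous (one_sub_exp t).
Proof.
move=> r; apply: cvgB; first exact: cvg_cst.
apply: (@continuous_comp _ _ _ (fun r : R => - (r * t)) expR);
  last exact: continuous_expR.
by apply: cvgN; apply: cvgM; [exact: cvg_id|exact: cvg_cst].
Qed.

Lemma one_sub_exp_ge0 t r : 0 <= t -> 0 <= r -> 0 <= one_sub_exp t r.
Proof. by move=> t0 r0; rewrite subr_ge0 -expR0 ler_expR oppr_le0 mulr_ge0. Qed.

Lemma one_sub_exp_le1 t r : one_sub_exp t r <= 1.
Proof. by rewrite gerBl expR_ge0. Qed.

Lemma le_one_sub_exp r : 0 <= r -> {homo one_sub_exp^~ r : s t / s <= t}.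
Proof. by move=> r0 s t st; rewrite lerB // ler_expR lerN2 ler_wpM2l. Qed.

Lemma cvg_one_sub_exp r : 0 < r -> one_sub_exp k%:R r @[k --> \oo] --> (1 : R).
Proof.
move=> r0; rewrite -[X in _ --> X]subr0; apply: cvgB; first exact: cvg_cst.
under eq_fun do rewrite mulr_natr -mulNrn -mulr_natr expRM_natr.
by apply: cvg_expr; rewrite ger0_norm ?expR_ge0 // expR_lt1 oppr_lt0.
Qed.

(** This identity is the source of the defect formula [defectE]: the function
    1 - e^{-rt} is additive in t up to a product. *)
Lemma one_sub_expD u v r :
  one_sub_exp u r + one_sub_exp v r =
  one_sub_exp (u + v) r + one_sub_exp u r * one_sub_exp v r.
Proof. by rewrite /one_sub_exp mulrDr opprD expRD; ring. Qed.

End ExpDefect.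

(** * The defect of additivity of a Bernstein function *)

Section Representation.
Context {R : realType} (g : R -> R) (a : R).
Variable sigma : {finite_measure set R -> \bar R}.
Hypothesis grepr : bernstein_repr g a sigma.

Definition defect u v : \bar R :=
  levy_integral sigma (fun r : R => one_sub_exp u r * one_sub_exp v r).

Lemma bernstein_reprE t : 0 <= t ->
  (g t)%:E = ((a * t)%:E + levy_integral sigma (one_sub_exp t))%E.
Proof. by move=> t0; rewrite (grepr.2 _ t0). Qed.

Let continuousM u v :
  continuous (fun r : R => one_sub_exp u r * one_sub_exp v r).
Proof. by move=> r; apply: cvgM; exact: continuous_one_sub_exp. Qed.

Lemma defect_ge0 u v : 0 <= u -> 0 <= v -> (0 <= defect u v)%E.
Proof.
move=> u0 v0; apply: levy_integral_ge0 => r r0.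
by rewrite mulr_ge0 // one_sub_exp_ge0 // ltW.
Qed.

Lemma defectE u v : 0 <= u -> 0 <= v ->
  ((g u + g v)%:E = (g (u + v))%:E + defect u v)%E.
Proof.
move=> u0 v0; have uv0 := addr_ge0 u0 v0.
have IE : (levy_integral sigma (one_sub_exp u) + levy_integral sigma (one_sub_exp v)
    = levy_integral sigma (one_sub_exp (u + v)%R) + defect u v)%E.
  rewrite /defect -!levy_integralD //; do ?exact: continuous_one_sub_exp;
    do ?by move=> r /ltW r0; rewrite ?mulr_ge0 ?one_sub_exp_ge0.
  by congr (levy_integral _ _); apply/funext => r; exact: one_sub_expD.
by rewrite EFinD !bernstein_reprE // addeACA IE -EFinD -mulrDr addeA.
Qed.

(** By [defectE] the defect is a difference of values of g, which are real. *)
Lemma defect_fin_num u v : 0 <= u -> 0 <= v -> defect u v \is a fin_num.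
Proof.
by move=> u0 v0; have := defectE _ _ u0 v0; case: (defect u v).
Qed.

Lemma le_defect s u v : 0 <= s -> s <= u -> s <= v ->
  (defect s s <= defect u v)%E.
Proof.
move=> s0 su sv; apply: le_levy_integral => // r /ltW r0.
rewrite mulr_ge0 ?one_sub_exp_ge0 //= ler_pM ?one_sub_exp_ge0 //;
  exact: le_one_sub_exp.
Qed.

Lemma bernstein_repr_subadd u v : 0 <= u -> 0 <= v -> g (u + v) <= g u + g v.
Proof. by move=> u0 v0; rewrite -lee_fin defectE // leeDl // defect_ge0. Qed.

Lemma bernstein_repr_defect_le s u v : 0 <= s -> s <= u -> s <= v ->
  g (u + v) + fine (defect s s) <= g u + g v.
Proof.
move=> s0 su sv; rewrite -lee_fin EFinD fineK ?defect_fin_num //.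
by rewrite defectE ?(le_trans s0) // leeD2l // le_defect.
Qed.

(** The functions (1 - e^{-rk})^2 increase to 1 with k, so a bound on the defects
    at (k, k) bounds the mass of the Levy measure, hence g(t) - a t. *)
Lemma defect_bounded (C : R) : (forall s, 0 <= s -> fine (defect s s) <= C) ->
  forall t, 0 <= t -> g t - a * t <= C.
Proof.
move=> dC t t0.
suff LC : (levy_integral sigma (one_sub_exp t) <= C%:E)%E.
  by rewrite lerBlDl -lee_fin bernstein_reprE // EFinD leeD2l.
apply: (@le_trans _ _ (levy_integral sigma (cst 1%R))).
  apply: le_levy_integral; first exact: continuous_one_sub_exp.
    by move=> r; exact: cvg_cst.
  by move=> r /ltW r0; rewrite one_sub_exp_ge0 // one_sub_exp_le1.
pose f k (r : R) := one_sub_exp k%:R r * one_sub_exp k%:R r.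
apply: (@levy_integral_cst1_le _ _ f) => //.
- by move=> k; exact: continuousM.
- by move=> k r /ltW r0; rewrite mulr_ge0 ?one_sub_exp_ge0.
- move=> r /ltW r0 k l kl.
  by rewrite ler_pM ?one_sub_exp_ge0 ?le_one_sub_exp ?ler_nat.
- by move=> r r0; rewrite -[X in _ --> X]mulr1; apply: cvgM; exact: cvg_one_sub_exp.
by move=> k; rewrite -[leLHS]fineK ?lee_fin ?dC // defect_fin_num.
Qed.

End Representation.

(** * The characterization *)

Theorem theorem7p3 (R : realType) (n : nat) (g : R -> R) (a : R)
    (sigma : {finite_measure set R -> \bar R})
    (hn : (2 <= n)%N)
    (hg : bernstein g) (hg0 : g 0 = 0)
    (ha : 0 <= a) (hrepr : bernstein_repr g a sigma)
    (hcase : (forall t : R, 0 <= t -> g t = a * t) \/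
             (g t - a * t @[t --> +oo] --> +oo)) :
  forall T : {set setpart n}, lower_set T ->
    ((forall x : 'rV[R]_n,
        lower_sum T (fun y : 'rV[R]_n => expR (- g (enorm y ^+ 2))) x = 0)
     <-> (forall t : R, 0 <= t -> g t = a * t)).
Proof.
move=> T lT; split; last by move=> ga; exact: (lower_sum_linear _ _ _ a).
move=> T0; case: hcase => // /cvgryPge goo; exfalso.
pose M : R := \sum_(p in T) `|(mobius T p \top%O)%:~R|.
have hM s : 0 <= s -> expR (fine (defect sigma s s)) <= M.
  move=> s0; have [_ topT _] := lT.
  apply: (lower_sum_eq0_defect_le _ n g s) => //; last exact: ltnW.
  - by move=> u v; exact: bernstein_repr_subadd hrepr u v.
  by move=> u v; exact: bernstein_repr_defect_le hrepr s u v s0.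
have gM t : 0 <= t -> g t - a * t <= M.
  apply: (defect_bounded _ _ _ hrepr) => s s0.
  apply: le_trans (hM _ s0); apply: le_trans (expR_ge1Dx _).
  by rewrite lerDr.
have [t [t0 tM]] : exists t, 0 <= t /\ M + 1 <= g t - a * t.
  near (pinfty_nbhs R) => t; exists t; split; near: t; last exact: goo.
  by apply: nbhs_pinfty_ge; exact: num_real.
have := le_trans tM (gM t t0); lra.
Unshelve. all: by end_near.
Qed.
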